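(* Let $k$ be an algebraically closed field of characteristic $p>2$, let $r\ge3$, and let $x_1,\dots,x_r=\infty$ be pairwise distinct closed points of $X=\mathbb{P}^1_k$, taken as marked points. Let $(\mathcal{E},\nabla)$ be an active, nilpotent, normalized indigenous bundle on $(X;x_1,\dots,x_r)$, let $L$ be the associated differential operator, let $d$ be the number of supersingular points of $(\mathcal{E},\nabla)$, and let $\alpha_r\in\mathbb{F}_p$ be the local exponent at $x_r$ of the flat line subbundle $\mathrm{Ker}(\gamma)\subset\mathcal{E}$, where $\gamma:\mathcal{E}\to\mathcal{O}_X$ is a horizontal surjection. (i) The equation $L(u)=0$ has a polynomial solution $u\in k[t]$ with simple zeros exactly in the supersingular points of $(\mathcal{E},\nabla)$. It is unique up to multiplication by a constant in $k^\times$. (ii) The local exponents of $L$ at $x_r=\infty$ are $(-d+\alpha_r,-d)$.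
   Context: $\Omega^{\log}_{X/k}=\Omega_{X/k}(\sum_i x_i)$ and $\tau^{\log}_{X/k}$ is its dual. A flat vector bundle is a vector bundle $\mathcal{E}$ on $X$ with a connection $\nabla:\mathcal{E}\to\mathcal{E}\otimes\Omega^{\log}_{X/k}$. The monodromy operator $\mu_i$ at $x_i$ is the endomorphism of the fiber $\mathcal{E}|_{x_i}$ induced by $\nabla(s\,\partial/\partial s)$, $s$ a local parameter at $x_i$; its eigenvalues are the local exponents at $x_i$. A filtration on a rank two flat bundle is a line subbundle $F^1\mathcal{E}\subset\mathcal{E}$ with $\mathrm{Gr}^1\mathcal{E}=\mathcal{E}/F^1\mathcal{E}$ a line bundle; its Kodaira--Spencer map is the $\mathcal{O}_X$-linear map $F^1\mathcal{E}\to\mathrm{Gr}^1\mathcal{E}\otimes\Omega^{\log}_{X/k}$ induced by $\nabla$. An indigenous bundle is a rank two flat bundle which has a filtration (the Hodge filtration; it is unique) whose Kodaira--Spencer map is an isomorphism, and with $\mu_i\neq0$ for all $i$. The $p$-curvature is the $\mathcal{O}_X$-linear map $\Psi_{\mathcal{E}}:(\tau^{\log}_{X/k})^{\otimes p}\to\mathrm{End}_{\mathcal{O}_X}(\mathcal{E})$, $\Psi_{\mathcal{E}}(D^{\otimes p})=\nabla(D)^p-\nabla(D^p)$. An indigenous bundle is active if $\Psi_{\mathcal{E}}\ne0$, nilpotent if the image of $\Psi_{\mathcal{E}}$ consists of nilpotent endomorphisms, normalized if there is a horizontal surjection $\gamma:\mathcal{E}\to\mathcal{O}_X$ (for an active nilpotent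 bundle, $\gamma$ is unique up to $k^\times$). For an active, nilpotent, normalized bundle, the canonical section is the unique rational section $e_0$ of $F^1\mathcal{E}$ with $\gamma(e_0)=1$, and the supersingular points are the points where $e_0$, as a section of $F^1\mathcal{E}$, has a pole. Supersingular points are never marked points, and the local exponents of $\mathrm{Ker}(\gamma)$ at marked points lie in $\mathbb{F}_p$. Associated differential operator: let $t$ be the standard parameter on $\mathbb{P}^1_k$, $D=\partial/\partial t$, $f'=D(f)$. Let $e_1$ be an everywhere invertible section of $F^1\mathcal{E}$ on $\mathbb{A}^1_k=X\setminus\{\infty\}$ (unique up to $k^\times$), and $e_2=\nabla(D)(e_1)$. Then $(e_1,e_2)$ is a basis of $\mathcal{E}$ on $X\setminus\{x_1,\dots,x_r\}$, and one writes $\nabla(D)(e_2)=-p_2e_1-p_1e_2$ with rational functions $p_1,p_2$. The operator is $L(u)=u''+p_1u'+p_2u$. It has regular singularities at the $x_i$. Its local exponents at $\infty$ are the roots $\rho$ of the indicial equation at $\infty$, $\rho(\rho+1)-c_1\rho+c_2=0$ with $c_1=(tp_1)(\infty)$, $c_2=(t^2p_2)(\infty)$ (so $\rho$ corresponds to leading behaviour $t^{-\rho}$); they are elements of $k$, and integers are read modulo $p$. *)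

(* Defs.v *)
(* Flat vector bundles with logarithmic poles on the projective line over a
   field k.  There are no schemes here: a vector bundle E on the curve X = P^1
   is given by its generic fiber, a finite dimensional vector space V over the
   function field k(t), together with its stalks E_y, each a free
   O_{X,y}-submodule of V of full rank.  The sections of E over an open set U
   are the v in V lying in E_y for every y in U, its rational sections are all
   of V, and sheaf-theoretic conditions are checked on stalks at closed points. *)

From mathcomp Require Import all_boot all_order all_algebra.
From mathcomp Require Import finmap.
From mathcomp Require Import classical_sets cardinality.

Set Implicit Arguments.
Unset Strict Implicit.
Unset Printing Implicit Defensive.

Import GRing.Theory.
Local Open Scope ring_scope.

(* Closed points of P^1_k for k algebraically closed: Some a is the point t = a
   and None is infinity. *)
Notation P1 k := (option k).

Definition infty (k : Type) : P1 k := None.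

Notation ratfun k := {fraction {poly k}}.

Definition ofpoly (k : fieldType) (q : {poly k}) : ratfun k := FracField.tofrac q.
Definition ofconst (k : fieldType) (c : k) : ratfun k := ofpoly c%:P.
Definition tpar (k : fieldType) : ratfun k := ofpoly 'X.
Arguments tpar {k}.

(* The derivation D = d/dt of k(t), by the quotient rule. *)
Definition ddt (k : fieldType) (f : ratfun k) : ratfun k :=
  let n : {poly k} := \n_(repr f) in
  let d : {poly k} := \d_(repr f) in
  ofpoly (n^`() * d - n * d^`()) / ofpoly (d ^+ 2).

Section LocalRings.
Variable k : fieldType.
Implicit Types (y : P1 k) (f : ratfun k).

(* f belongs to the local ring O_{X,y} and has value c in its residue field. *)
Definition value_at y f (c : k) : Prop :=
  exists n d : {poly k}, f = ofpoly n / ofpoly d /\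
    match y with
    | Some a => d.[a] != 0 /\ n.[a] = c * d.[a]
    | None => [/\ d != 0, (size n <= size d)%N
                & n`_(size d).-1 = c * lead_coef d]
    end.

Definition regular_at y f : Prop := exists c, value_at y f c.

(* The local parameter s at y: t - a at a, and 1/t at infinity. *)
Definition local_param y : ratfun k :=
  match y with
  | Some a => ofpoly ('X - a%:P)
  | None => tpar^-1
  end.

(* A rational vector field f D is represented by its coefficient f with respect
   to D = d/dt; at infinity d/ds = - t^2 D. *)
Definition ds_field y : ratfun k :=
  match y with
  | Some _ => 1
  | None => - tpar ^+ 2
  end.

Definition sds_field y : ratfun k := local_param y * ds_field y.

Section Log.
Variables (r : nat) (x : 'I_r -> P1 k).

(* A generator of the stalk at y of the sheaf tau^log of vector fields with
   logarithmic zeros at the marked points, the dual of Omega(sum_i x_i). *)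
Definition tau_log_gen y : ratfun k :=
  if y \in codom x then sds_field y else ds_field y.

Definition tau_log y f : Prop :=
  exists2 g, regular_at y g & f = g * tau_log_gen y.

End Log.

(* b is a basis of V over k(t), and M is the free O_{X,y}-module on b. *)
Definition local_basis (V : vectType (ratfun k)) y (M : V -> Prop) n
    (b : n.-tuple V) : Prop :=
  basis_of fullv b /\
  forall v, M v <-> forall i : 'I_n, regular_at y (coord b i v).

(* Away from finitely many points, all stalks are spanned by one common basis
   of the generic fiber. *)
Record vbundle := VBundle {
  generic_fiber :> vectType (ratfun k);
  stalk : P1 k -> generic_fiber -> Prop;
  stalk_lattice : forall y, exists b : (\dim {:generic_fiber}).-tuple generic_fiber,
    local_basis y (stalk y) b;
  stalk_coherent : exists (b : (\dim {:generic_fiber}).-tuple generic_fiber)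
      (S : seq (P1 k)),
    forall y, y \notin S -> local_basis y (stalk y) b
}.

Definition rank (E : vbundle) : nat := \dim {:E}.

(* m_y M_y, where m_y is the maximal ideal of O_{X,y}; the fiber at y of the
   sheaf M is M_y / m_y M_y. *)
Definition max_mul (V : vectType (ratfun k)) (M : P1 k -> V -> Prop) y v : Prop :=
  exists2 w, M y w & v = local_param y *: w.

(* Line subbundles of a rank two bundle whose quotient is a line bundle: locally
   there is a basis (f, g) of E with f a basis of the subbundle, so that g is
   a basis of the quotient.  The generic fiber sub_line is the space of rational
   sections. *)
Record line_subbundle (E : vbundle) := LineSubbundle {
  sub_line : {vspace E};
  sub_stalk : P1 k -> E -> Prop;
  sub_line_dim : \dim sub_line = 1%N;
  sub_stalkP : forall y, exists f g : E,
    [/\ local_basis y (stalk y) [tuple f; g],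
        f \in sub_line
      & forall v, sub_stalk y v <-> exists2 c, regular_at y c & v = c *: f]
}.

End LocalRings.

Section FlatBundles.
Variables (k : fieldType) (r : nat) (x : 'I_r -> P1 k).

(* nabla is the operator nabla(D) on rational sections, so that
   nabla(f D) = f nabla(D).  The connection takes values in E (x) Omega^log iff
   nabla(theta) preserves E_y for theta a generator of tau^log_y. *)
Record flat_bundle := FlatBundle {
  bundle :> vbundle k;
  nabla : bundle -> bundle;
  nablaD : {morph nabla : v w / v + w};
  nabla_Leibniz : forall (f : ratfun k) (v : bundle),
    nabla (f *: v) = ddt f *: v + f *: nabla v;
  nabla_log : forall (y : P1 k) (v : bundle), stalk y v ->
    stalk y (tau_log_gen x y *: nabla v)
}.

Variable E : flat_bundle.

Definition nabla_along (f : ratfun k) (v : E) : E := f *: nabla v.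

(* The monodromy operator at y, induced by nabla(s d/ds) on the fiber of E at y,
   is not zero. *)
Definition monodromy_neq0 (y : P1 k) : Prop :=
  exists2 v : E, stalk y v &
    ~ max_mul (@stalk k E) y (nabla_along (sds_field y) v).

(* a is an eigenvalue of the operator induced by nabla(s d/ds) on the fiber
   M_y / m_y M_y of the flat subsheaf M of E. *)
Definition local_exponent (M : P1 k -> E -> Prop) (y : P1 k) (a : k) : Prop :=
  exists v : E, [/\ M y v, ~ max_mul M y v
    & max_mul M y (nabla_along (sds_field y) v - ofconst a *: v)].

(* The Kodaira-Spencer map F_y -> (E/F)_y (x) Omega^log_y, contracted with the
   generator theta of tau^log_y, sends v to the class of nabla(theta) v. *)
Definition KS_isomorphism (F : line_subbundle E) : Prop :=
  forall y : P1 k,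
    (forall v, sub_stalk F y v ->
       sub_stalk F y (nabla_along (tau_log_gen x y) v) -> v = 0) /\
    (forall w, stalk y w -> exists2 v, sub_stalk F y v &
       sub_stalk F y (w - nabla_along (tau_log_gen x y) v)).

Definition Hodge_filtration (F : line_subbundle E) : Prop := KS_isomorphism F.

Definition indigenous : Prop :=
  [/\ rank E = 2%N, exists F : line_subbundle E, Hodge_filtration F
    & forall i : 'I_r, monodromy_neq0 (x i)].

(* For theta = f D, the p-th power of the derivation theta is, in characteristic
   p, the derivation theta^p(t) D. *)
Definition p_curvature (p : nat) (f : ratfun k) (v : E) : E :=
  iter p (nabla_along f) v
  - nabla_along (iter p (fun h => f * ddt h) tpar) v.

Definition active (p : nat) : Prop :=
  exists (y : P1 k) (f : ratfun k) (v : E),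
    [/\ tau_log x y f, stalk y v & p_curvature p f v <> 0].

(* As tau^log is a line bundle, the elements of the stalk of its p-th tensor power
   are the g theta^{(x) p}, g in O_{X,y}, and such an element is mapped to
   g Psi(theta^{(x) p}). *)
Definition nilpotent (p : nat) : Prop :=
  forall (y : P1 k) (f g : ratfun k), tau_log x y f -> regular_at y g ->
    exists n : nat, forall v : E, stalk y v ->
      iter n (fun w => g *: p_curvature p f w) v = 0.

(* Horizontal surjections of E onto O_X with its trivial connection. *)
Definition horizontal_surjection (gamma : {linear E -> (ratfun k)^o}) : Prop :=
  [/\ forall (y : P1 k) v, stalk y v -> regular_at y (gamma v),
      forall (y : P1 k) f, regular_at y f -> exists2 v, stalk y v & gamma v = f
    & forall v, gamma (nabla v) = ddt (gamma v)].

Definition normalized : Prop :=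
  exists gamma : {linear E -> (ratfun k)^o}, horizontal_surjection gamma.

Definition ker_stalk (gamma : {linear E -> (ratfun k)^o}) (y : P1 k) (v : E) : Prop :=
  stalk y v /\ gamma v = 0.

Definition canonical_section (F : line_subbundle E)
    (gamma : {linear E -> (ratfun k)^o}) (e0 : E) : Prop :=
  e0 \in sub_line F /\ gamma e0 = 1.

(* The points at which the canonical section e0 has a pole as a section of F. *)
Definition supersingular (F : line_subbundle E) (e0 : E) : set (P1 k) :=
  fun y => ~ sub_stalk F y e0.

End FlatBundles.

Record diff_operator (k : fieldType) := DiffOperator {
  coef1 : ratfun k;
  coef2 : ratfun k
}.

Definition diff_apply (k : fieldType) (L : diff_operator k) (u : ratfun k) : ratfun k :=
  ddt (ddt u) + coef1 L * ddt u + coef2 L * u.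

Definition invertible_on_A1 (k : fieldType) (E : vbundle k) (F : line_subbundle E)
    (e1 : E) : Prop :=
  forall (a : k) (v : E), sub_stalk F (Some a) v <->
    exists2 c, regular_at (Some a) c & v = c *: e1.

Definition associated_operator (k : fieldType) (r : nat) (x : 'I_r -> P1 k)
    (E : flat_bundle x) (F : line_subbundle E) (L : diff_operator k) : Prop :=
  exists2 e1 : E, invertible_on_A1 F e1 &
    let e2 := nabla e1 in
    nabla e2 = - (coef2 L *: e1) - coef1 L *: e2.

(* The two local exponents at infinity, with multiplicity, are the roots of the
   indicial polynomial. *)
Definition local_exponents_at_infty (k : fieldType) (L : diff_operator k)
    (a b : k) : Prop :=
  exists c1 c2 : k,
    [/\ value_at (infty k) (tpar * coef1 L) c1,
        value_at (infty k) (tpar ^+ 2 * coef2 L) c2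
      & 'X * ('X + 1) - c1 *: 'X + c2%:P = ('X - a%:P) * ('X - b%:P)].

(* The zeros of u are the affine points of S, and all are simple. *)
Definition simple_zeros_exactly (k : fieldType) (u : {poly k}) (S : set (P1 k)) : Prop :=
  u != 0 /\
  forall a : k, (root u a <-> S (Some a)) /\ (root u a -> mup a u = 1%N).

(* fset_set is empty on infinite sets; the supersingular points are the zeros of
   a nonzero polynomial, hence finite in number. *)
Definition number_of_points (k : choiceType) (S : set (P1 k)) : nat :=
  #|` fset_set S|.

(* Main.v *)
Require Import Defs.
From mathcomp Require Import all_boot all_order all_algebra.
From mathcomp Require Import finmap classical_sets cardinality ring.

(* Let e be a local generator of the Hodge filtration F at y and theta a generator
   of tau^log at y.  As the Kodaira-Spencer map is an isomorphism, e and
   nabla(theta) e form a local basis of E, so gamma(e) and theta(gamma(e)) do not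
   both vanish at y.  If y is marked, theta maps O_y into m_y, so gamma(e) is a
   unit; otherwise gamma(e) has at most a simple zero.  For e_1 = u e_0 this shows
   that the polynomial u = gamma(e_1) has simple zeros, exactly at the supersingular
   points; applying gamma to the equation of e_1 gives L(u) = 0.
   At infinity, e_0 generates F.  With theta = - t D, the section
   h = nabla(theta) e_0 generates Ker(gamma), and nabla(theta) h = c h with
   c(infinity) = alpha_r.  Writing out nabla(D)^2 (u e_0) in the basis (e_0, h)
   expresses p_1 and p_2 by c and u, which gives the indicial equation. *)

Set Implicit Arguments.
Unset Strict Implicit.
Unset Printing Implicit Defensive.

Import GRing.Theory.
Local Open Scope ring_scope.

(** * Top coefficients of products and of Euler-type derivatives of polynomials *)

Section Polynomials.
Variable R : nzRingType.
Implicit Types (p q : {poly R}) (m n : nat).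

Lemma size_polyM_leq p q m n :
  (size p <= m.+1)%N -> (size q <= n.+1)%N -> (size (p * q)%R <= (m + n).+1)%N.
Proof.
move=> hp hq; apply: leq_trans (size_polyMleq _ _) _.
by rewrite -subn1 leq_subLR add1n -addnS -addSn leq_add.
Qed.

(** Every other term of the convolution has an index beyond one of the two size bounds. This
    evaluates products at infinity, where values are ratios of top coefficients. *)
Lemma coefM_top p q m n :
  (size p <= m.+1)%N -> (size q <= n.+1)%N -> (p * q)`_(m + n) = p`_m * q`_n.
Proof.
move=> hp hq; have hm : (m < (m + n).+1)%N by rewrite ltnS leq_addr.
rewrite coefM (bigD1 (Ordinal hm)) //= addKn big1 ?addr0 // => i.
rewrite -val_eqE /= neq_ltn => /orP[lt_im|lt_mi].
  rewrite [q`__]nth_default ?mulr0 //; apply: leq_trans hq _.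
  by rewrite ltn_subRL ltn_add2r.
by rewrite nth_default ?mul0r //; apply: leq_trans lt_mi.
Qed.

Lemma coef_Xderiv p i : ('X * p^`())`_i = p`_i *+ i.
Proof. by rewrite coefXM; case: i => [|i]; rewrite ?mulr0n //= coef_deriv. Qed.

Lemma coef_XXderiv2 p i : ('X * ('X * p^`()^`()))`_i = p`_i *+ (i * i.-1).
Proof.
rewrite !coefXM; case: i => [|[|i]]; rewrite ?mulr0n ?muln0 //=.
by rewrite !coef_deriv -mulrnA mulnC.
Qed.

Lemma size_XXderiv2 p : (size ('X * ('X * p^`()^`()))%R <= size p)%N.
Proof.
by apply/leq_sizeP => i hi; rewrite coef_XXderiv2 nth_default // mul0rn.
Qed.

Lemma size_Xderiv p : (size ('X * p^`())%R <= size p)%N.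
Proof.
by apply/leq_sizeP => i hi; rewrite coef_Xderiv nth_default // mul0rn.
Qed.

End Polynomials.

(** * Rational functions: the derivation, local rings and values at closed points *)

Section RationalFunctions.
Variable k : fieldType.
Implicit Types (n d q : {poly k}) (f g : ratfun k) (y : P1 k).

Lemma ofpolyD n d : ofpoly (n + d) = ofpoly n + ofpoly d.
Proof. exact: rmorphD. Qed.
Lemma ofpolyB n d : ofpoly (n - d) = ofpoly n - ofpoly d.
Proof. exact: rmorphB. Qed.
Lemma ofpolyN n : ofpoly (- n) = - ofpoly n.
Proof. exact: rmorphN. Qed.
Lemma ofpolyM n d : ofpoly (n * d) = ofpoly n * ofpoly d.
Proof. exact: rmorphM. Qed.
Lemma ofpolyX n m : ofpoly (n ^+ m) = ofpoly n ^+ m.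
Proof. exact: rmorphXn. Qed.
Lemma ofpoly0 : ofpoly (0 : {poly k}) = 0.
Proof. exact: rmorph0. Qed.
Lemma ofpoly1 : ofpoly (1 : {poly k}) = 1.
Proof. exact: rmorph1. Qed.
Lemma ofpoly_eq0 n : (ofpoly n == 0) = (n == 0).
Proof. exact: tofrac_eq0. Qed.
Lemma ofpoly_inj : injective (@ofpoly k).
Proof. by move=> n d /eqP; rewrite /ofpoly tofrac_eq => /eqP. Qed.
Lemma tpar_neq0 : tpar != 0 :> ratfun k.
Proof. by rewrite ofpoly_eq0 polyX_eq0. Qed.

Lemma ofpoly_div_eq n d n' d' : d != 0 -> d' != 0 ->
  (ofpoly n / ofpoly d == ofpoly n' / ofpoly d') = (n * d' == n' * d).
Proof.
by move=> hd hd'; rewrite eqr_div ?ofpoly_eq0 // -!ofpolyM (inj_eq ofpoly_inj).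
Qed.

Lemma ofpoly_repr f : f = ofpoly \n_(repr f) / ofpoly \d_(repr f).
Proof.
have hd : ofpoly \d_(repr f) != 0 by rewrite ofpoly_eq0 denom_ratioP.
apply: (mulIf hd); rewrite divfK //.
move: (repr f) (reprK f) => z <-; apply/eqP.
rewrite -[_ * _]/(FracField.mul _ _) /ofpoly !piE FracField.equivfE /FracField.mulf.
by rewrite !numden_Ratio ?mulf_neq0 ?oner_eq0 ?denom_ratioP // !mulr1 mulrC.
Qed.

(** [ddt] is computed on a chosen representative [n0 / d0]. The difference of the cross-multiplied
    quotient rules is a combination of the relation [n0 * d = n * d0] and its derivative, hence
    zero. *)
Lemma ddt_frac n d : d != 0 ->
  ddt (ofpoly n / ofpoly d) = ofpoly (n^`() * d - n * d^`()) / ofpoly (d ^+ 2).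
Proof.
move=> hd; set f := _ / _; rewrite /ddt.
set n0 := \n_(repr f); set d0 := \d_(repr f).
have hd0 : d0 != 0 by rewrite /d0 denom_ratioP.
have e : n0 * d = n * d0.
  by apply/eqP; rewrite -ofpoly_div_eq // eq_sym -/f [f]ofpoly_repr.
have e' : n0^`() * d + n0 * d^`() = n^`() * d0 + n * d0^`() by rewrite -!derivM e.
apply/eqP; rewrite ofpoly_div_eq ?expf_neq0 // -subr_eq0.
have -> : (n0^`() * d0 - n0 * d0^`()) * d ^+ 2 - (n^`() * d - n * d^`()) * d0 ^+ 2
  = d * d0 * ((n0^`() * d + n0 * d^`()) - (n^`() * d0 + n * d0^`()))
    - (d * d0^`() + d0 * d^`()) * (n0 * d - n * d0) by ring.
by rewrite e e' !subrr !mulr0 subrr.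
Qed.

Lemma ddt_poly n : ddt (ofpoly n) = ofpoly n^`().
Proof.
have := ddt_frac n (oner_neq0 _).
by rewrite derivE mulr0 subr0 mulr1 expr1n ofpoly1 !divr1.
Qed.

Lemma value_at_polyE n d y (c : k) : d != 0 ->
  match y with
  | Some a => d.[a] != 0 /\ n.[a] = c * d.[a]
  | None => (size n <= size d)%N /\ n`_(size d).-1 = c * lead_coef d
  end -> value_at y (ofpoly n / ofpoly d) c.
Proof. by move=> hd; case: y => [a|] []; exists n, d. Qed.

Lemma value_at_fracP y f c : value_at y f c ->
  exists n d, [/\ f = ofpoly n / ofpoly d, d != 0 &
    match y with
    | Some a => d.[a] != 0 /\ n.[a] = c * d.[a]
    | None => (size n <= size d)%N /\ n`_(size d).-1 = c * lead_coef d
    end].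
Proof.
case=> n [d [-> h]]; exists n, d; case: y h => [a|] [] // hd hn; split => //.
by apply: contraNneq hd => ->; rewrite horner0.
Qed.

Lemma value_atD y f g a b :
  value_at y f a -> value_at y g b -> value_at y (f + g) (a + b).
Proof.
move=> /value_at_fracP[n [d [-> hd hf]]] /value_at_fracP[n' [d' [-> hd' hg]]].
rewrite addf_div ?ofpoly_eq0 // -!ofpolyM -ofpolyD.
apply: value_at_polyE; first by rewrite mulf_neq0.
case: y hf hg => [t|] [h1 h2] [h1' h2'].
  by rewrite ?hornerD !hornerM mulf_neq0 // h2 h2'; split=> //; ring.
(* At infinity the value is the ratio of the coefficients in degree [(size d).-1], and these degrees
   add up in [d * d']. *)
have [sd sd'] := (polySpred hd, polySpred hd').
have sdd : size (d * d') = ((size d).-1 + (size d').-1).+1.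
  by rewrite size_mul // {1}sd {1}sd' addSn addnS.
rewrite sd in h1; rewrite sd' in h1'.
have Ed : (size d <= (size d).-1.+1)%N by rewrite -sd.
have Ed' : (size d' <= (size d').-1.+1)%N by rewrite -sd'.
rewrite sdd lead_coefM /=; split.
  rewrite (leq_trans (size_polyD _ _)) // geq_max size_polyM_leq //=.
  by rewrite addnC size_polyM_leq.
rewrite coefD coefM_top // [X in _ + _`_X]addnC coefM_top // h2 h2' /lead_coef.
ring.
Qed.

Lemma value_atM y f g a b :
  value_at y f a -> value_at y g b -> value_at y (f * g) (a * b).
Proof.
move=> /value_at_fracP[n [d [-> hd hf]]] /value_at_fracP[n' [d' [-> hd' hg]]].
rewrite mulf_div -!ofpolyM.
apply: value_at_polyE; first by rewrite mulf_neq0.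
case: y hf hg => [t|] [h1 h2] [h1' h2'].
  by rewrite ?hornerD !hornerM mulf_neq0 // h2 h2'; split=> //; ring.
have [sd sd'] := (polySpred hd, polySpred hd').
have sdd : size (d * d') = ((size d).-1 + (size d').-1).+1.
  by rewrite size_mul // {1}sd {1}sd' addSn addnS.
rewrite sd in h1; rewrite sd' in h1'.
rewrite sdd lead_coefM /=; split; first exact: size_polyM_leq.
rewrite coefM_top // h2 h2'; ring.
Qed.

Lemma value_at_const y c : value_at y (ofconst c) c.
Proof.
rewrite /ofconst -[ofpoly _]divr1 -ofpoly1; apply: value_at_polyE.
  exact: oner_neq0.
case: y => [a|]; first by rewrite !hornerE oner_neq0.
by rewrite size_poly1 lead_coef1 coefC eqxx mulr1 size_polyC leq_b1.
Qed.

Lemma value_at_nat y m : value_at y m%:R m%:R.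
Proof.
have := value_at_const y m%:R.
by rewrite /ofconst polyC_natr /ofpoly rmorph_nat.
Qed.

Lemma value_atN y f a : value_at y f a -> value_at y (- f) (- a).
Proof.
move=> h; rewrite -mulN1r -[- a]mulN1r; apply: value_atM h.
by have := value_at_const y (-1); rewrite /ofconst polyCN ofpolyN ofpoly1.
Qed.

Lemma value_atB y f g a b :
  value_at y f a -> value_at y g b -> value_at y (f - g) (a - b).
Proof. by move=> hf /value_atN; apply: value_atD. Qed.

Lemma value_at_inj y f a b : value_at y f a -> value_at y f b -> a = b.
Proof.
move=> hf hg; apply/eqP; rewrite -subr_eq0; apply/eqP.
have /value_at_fracP [n [d [/esym/eqP]]] := value_atB hf hg.
rewrite subrr => + hd; rewrite mulf_eq0 invr_eq0 !ofpoly_eq0 (negPf hd) orbF.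
move=> /eqP ->; case: y {hf hg} => [t|] [h1 h2].
  by move/esym/eqP: h2; rewrite horner0 mulf_eq0 (negPf h1) orbF => /eqP.
move/esym/eqP: h2; rewrite coef0 mulf_eq0 lead_coef_eq0 (negPf hd) orbF.
by move/eqP.
Qed.

Lemma value_atV y f a : a != 0 -> value_at y f a -> value_at y f^-1 a^-1.
Proof.
move=> ha /value_at_fracP[n [d [-> hd hf]]]; rewrite invf_div.
case: y hf => [t|] [h1 h2].
  have hn : n.[t] != 0 by rewrite h2 mulf_neq0.
  apply: value_at_polyE; first by apply: contraNneq hn => ->; rewrite horner0.
  by rewrite h2 mulKf -?h2.
(* A nonzero value at infinity forces numerator and denominator to have the same degree. *)
have hn : n`_(size d).-1 != 0 by rewrite h2 mulf_neq0 ?lead_coef_eq0.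
have hs : size n = size d.
  apply/eqP; rewrite eqn_leq h1 (polySpred hd) ltnNge.
  by apply: contra hn => le; rewrite nth_default.
have hn0 : n != 0 by rewrite -size_poly_eq0 hs size_poly_eq0.
by apply: value_at_polyE; rewrite // /lead_coef hs h2 mulKf.
Qed.

Lemma regular_at0 y : regular_at y 0.
Proof. by exists 0; apply: (value_at_nat y 0). Qed.

Lemma regular_at1 y : regular_at y 1.
Proof. by exists 1; apply: (value_at_nat y 1). Qed.

Lemma regular_atD y f g : regular_at y f -> regular_at y g -> regular_at y (f + g).
Proof. by move=> [a ha] [b hb]; exists (a + b); apply: value_atD. Qed.

Lemma regular_atB y f g : regular_at y f -> regular_at y g -> regular_at y (f - g).
Proof. by move=> [a ha] [b hb]; exists (a - b); apply: value_atB. Qed.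

Lemma regular_atM y f g : regular_at y f -> regular_at y g -> regular_at y (f * g).
Proof. by move=> [a ha] [b hb]; exists (a * b); apply: value_atM. Qed.

Lemma value_at_poly (a : k) n : value_at (Some a) (ofpoly n) n.[a].
Proof.
rewrite -[ofpoly n]divr1 -ofpoly1; apply: value_at_polyE; first exact: oner_neq0.
by rewrite !hornerE oner_neq0.
Qed.

Lemma value_at_local_param y : value_at y (local_param y) 0.
Proof.
case: y => [a|] /=; first by have := value_at_poly a ('X - a%:P); rewrite !hornerE subrr.
rewrite -[tpar^-1]mul1r -ofpoly1; apply: value_at_polyE; first by rewrite polyX_eq0.
by rewrite size_poly1 size_polyX /= coef1 mul0r.
Qed.

(** At an affine point the factor [t - a] vanishes and the derivative is regular. At infinity the
    field is [- t D], and the top coefficients of [n * ('X * d^]())[and]('X * n^[()) * d] cancel. *)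
Lemma value_at_sds y f : regular_at y f -> value_at y (sds_field y * ddt f) 0.
Proof.
case=> c /value_at_fracP[n [d [-> hd hf]]]; rewrite ddt_frac //.
case: y hf => [a|] [h1 h2]; rewrite /sds_field /=.
  rewrite mulr1 mulrA -ofpolyM; apply: value_at_polyE; first by rewrite expf_neq0.
  by rewrite !hornerE subrr !mul0r expf_neq0.
have -> : tpar^-1 * - tpar ^+ 2 = - tpar :> ratfun k.
  by rewrite mulrN expr2 mulKf ?tpar_neq0.
rewrite mulrA -ofpolyN -ofpolyM; apply: value_at_polyE; first by rewrite expf_neq0.
have sd := polySpred hd; set m := (size d).-1 in sd h2 *.
have -> : - 'X * (n^`() * d - n * d^`()) = n * ('X * d^`()) - ('X * n^`()) * d by ring.
have sdd : size (d ^+ 2) = (m + m).+1 by rewrite expr2 size_mul // sd addSn addnS.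
have Hn : (size n <= m.+1)%N by rewrite -sd.
have Hd : (size d <= m.+1)%N by rewrite -sd.
have Xn := leq_trans (size_Xderiv n) Hn; have Xd := leq_trans (size_Xderiv d) Hd.
rewrite sdd; split=> /=.
  by rewrite (leq_trans (size_polyD _ _)) // geq_max size_polyN !size_polyM_leq.
by rewrite mul0r coefB !coefM_top // !coef_Xderiv mulrnAl mulrnAr subrr.
Qed.

(** The maximal ideal at infinity is generated by [1/t]: a zero coefficient in degree [(size d).-1]
    leaves room for a factor ['X] in the numerator. *)
Lemma value_at_infty0 f : value_at (infty k) f 0 ->
  exists2 g, regular_at (infty k) g & f = local_param (infty k) * g.
Proof.
move=> /value_at_fracP[n [d [-> hd [h1 h2]]]].
exists (ofpoly ('X * n) / ofpoly d); last first.
  by rewrite /= ofpolyM -[ofpoly 'X]/tpar -!mulrA mulKf ?tpar_neq0.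
have [->|hn] := eqVneq n 0.
  by rewrite mulr0 ofpoly0 mul0r; apply: regular_at0.
exists (('X * n)`_(size d).-1 / lead_coef d); apply: value_at_polyE => //.
rewrite divfK ?lead_coef_eq0 //; split=> //.
rewrite mulrC size_mulX //; rewrite (polySpred hd) in h1 *.
rewrite ltnS; apply/leq_sizeP => i; rewrite leq_eqVlt => /orP[/eqP <-|lt_i].
  by rewrite h2 mul0r.
by rewrite nth_default //; apply: leq_trans lt_i.
Qed.

Lemma value_at_infty_poly n d : d != 0 -> (size n <= size d)%N ->
  value_at (infty k) (ofpoly n / ofpoly d) (n`_(size d).-1 / lead_coef d).
Proof. by move=> hd hn; apply: value_at_polyE; rewrite // divfK ?lead_coef_eq0. Qed.

End RationalFunctions.

(** * Local bases of rank two and their changes *)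

Section Frames.
Variables (k : fieldType) (V : vectType (ratfun k)) (y : P1 k) (M : V -> Prop).
Implicit Types (a b c : ratfun k) (f g v : V).

(** A form of [local_basis] for pairs that avoids [coord], so that a change of basis is a
    computation with coefficients. *)
Definition frame f g : Prop :=
  [/\ forall v, exists a b, v = a *: f + b *: g,
      forall a b, M (a *: f + b *: g) <-> regular_at y a /\ regular_at y b
    & forall a b, a *: f + b *: g = 0 -> a = 0 /\ b = 0].

Lemma local_basis_frame f g : local_basis y M [tuple f; g] -> frame f g.
Proof.
case=> hb hM; have hfree := basis_free hb; split.
- move=> v; exists (coord [tuple f; g] ord0 v), (coord [tuple f; g] ord_max v).
  rewrite {1}[v](coord_basis hb (memvf v)) !big_ord_recl big_ord0 addr0 /=.
  by congr (_ + coord _ _ _ *: _); apply: val_inj.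
- move=> a b; rewrite hM.
  have hc i : coord [tuple f; g] i (a *: f + b *: g) = if i == ord0 then a else b.
    rewrite linearD !linearZ /= -[X in coord _ _ X]/([tuple f; g]`_(ord0 : 'I_2)).
    rewrite -[X in _ + _ * coord _ _ X]/([tuple f; g]`_(ord_max : 'I_2)).
    rewrite !coord_free //.
    by case: i => -[|[|]] //= _; rewrite ?mulr1 ?mulr0 ?addr0 ?add0r.
  split=> [h|[ha hb'] i]; last by rewrite hc; case: ifP.
  by have [h1 h2] := (h ord0, h ord_max); rewrite !hc in h1 h2.
- move=> a b h; have /freeP/(_ (fun i => if i == ord0 then a else b)) := hfree.
  rewrite !big_ord_recl big_ord0 addr0 /= => /(_ h) h'.
  by split; [apply: (h' ord0)|apply: (h' ord_max)].
Qed.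

Lemma frame_inj f g a b a' b' : frame f g ->
  a *: f + b *: g = a' *: f + b' *: g -> a = a' /\ b = b'.
Proof.
case=> _ _ h /eqP; rewrite -subr_eq0 opprD addrACA -!scalerBl => /eqP /h [].
by move=> /eqP + /eqP; rewrite !subr_eq0 => /eqP -> /eqP ->.
Qed.

Lemma frame_scale f g c c' : regular_at y c -> regular_at y c' -> c * c' = 1 ->
  frame f g -> frame (c *: f) g.
Proof.
move=> hc hc' cc' [hv hM hf].
have E a b : a *: (c *: f) + b *: g = (a * c) *: f + b *: g by rewrite scalerA.
split.
- move=> v; have [a [b ->]] := hv v; exists (a * c'), b.
  by rewrite E -mulrA [c' * c]mulrC cc' mulr1.
- move=> a b; rewrite E hM; split=> -[ha hb]; split=> //; last exact: regular_atM.
  by rewrite -[a]mulr1 -cc' mulrA; apply: regular_atM.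
- move=> a b; rewrite E => /hf[h ->]; split=> //.
  by rewrite -[a]mulr1 -cc' mulrA h mul0r.
Qed.

(** The change of basis is triangular with the unit [b] on the diagonal. It serves to replace [g] by
    the derivative of [f] along [theta]. *)
Lemma frame_shear f g a b b' : regular_at y a -> regular_at y b ->
  regular_at y b' -> b * b' = 1 -> frame f g -> frame f (a *: f + b *: g).
Proof.
move=> ha hb hb' bb' [hv hM hf].
have E c d : c *: f + d *: (a *: f + b *: g) = (c + d * a) *: f + (d * b) *: g.
  by rewrite scalerDr !scalerA addrA -scalerDl.
have bK d : d = d * b * b' by rewrite -mulrA bb' mulr1.
split.
- move=> v; have [c [d ->]] := hv v; exists (c - d * b' * a), (d * b').
  by rewrite E subrK -mulrA [b' * b]mulrC bb' mulr1.
- move=> c d; rewrite E hM; split=> -[hc hd].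
    have hd' : regular_at y d by rewrite [d]bK; apply: regular_atM.
    split=> //; rewrite -[c](addrK (d * a)).
    by apply: regular_atB => //; apply: regular_atM.
  by split; [apply: regular_atD => //|]; apply: regular_atM.
- move=> c d; rewrite E => /hf[h1 h2].
  have d0 : d = 0 by rewrite [d]bK h2 mul0r.
  by move: h1; rewrite d0 mul0r addr0.
Qed.

Lemma frame_mem1 f g : frame f g -> M f.
Proof.
case=> _ hM _; have := (hM 1 0).2; rewrite scale1r scale0r addr0; apply.
by split; [apply: regular_at1 | apply: regular_at0].
Qed.

Lemma frame_mem2 f g : frame f g -> M g.
Proof.
case=> _ hM _; have := (hM 0 1).2; rewrite scale1r scale0r add0r; apply.
by split; [apply: regular_at0 | apply: regular_at1].
Qed.

Lemma frame_neq0 f g : frame f g -> f != 0.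
Proof.
case=> _ _ hf; apply/negP => /eqP f0; have := hf 1 0.
rewrite f0 scaler0 scale0r addr0 => /(_ erefl) [/eqP].
by rewrite oner_eq0.
Qed.

End Frames.

(** * Local generators of a line subbundle *)

Section LineSubbundles.
Variables (k : fieldType) (E : vbundle k) (F : line_subbundle E).

(** [invertible_on_A1 F e] is this condition at every affine point. *)
Definition generates (y : P1 k) (e : E) : Prop :=
  forall v, sub_stalk F y v <-> exists2 c, regular_at y c & v = c *: e.

Lemma generates_mem y e : generates y e -> sub_stalk F y e.
Proof.
by move=> h; apply/h; exists 1; rewrite ?scale1r //; apply: regular_at1.
Qed.

(** [e] and the generator [f] provided by [sub_stalkP] are regular multiples of each other, so they
    differ by a unit and [e] can replace [f] in the local basis. *)
Lemma generates_frame y e : generates y e ->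
  e \in sub_line F /\ exists g, frame y (@stalk k E y) e g.
Proof.
move=> he; have [f [g [hb hf hF]]] := sub_stalkP F y.
have hfg := local_basis_frame hb.
have [c hc ec] := (hF e).1 (generates_mem he).
have [c' hc' fc'] := (he f).1 (generates_mem hF).
have cc' : c * c' = 1.
  have [] := @frame_inj _ _ _ _ f g (c * c') 0 1 0 hfg => //.
  by rewrite scale0r !addr0 scale1r mulrC -scalerA -ec -fc'.
by split; [rewrite ec memvZ|exists g; rewrite ec; apply: frame_scale cc' hfg].
Qed.

Lemma sub_line_scale y e v : generates y e -> v \in sub_line F ->
  exists c, v = c *: e.
Proof.
move=> /generates_frame [he [g /frame_neq0 e0]].
have -> : sub_line F = <[e]>%VS.
  apply/esym/eqP; rewrite eqEdim -memvE he sub_line_dim.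
  by rewrite dim_vline e0.
by case/vlineP => c ->; exists c.
Qed.

End LineSubbundles.

(** * The Kodaira-Spencer isomorphism and the values of [gamma] on the Hodge filtration *)

Section HodgeFiltration.
Variables (k : fieldType) (r : nat) (x : 'I_r -> P1 k) (E : flat_bundle x).
Variables (F : line_subbundle E) (F_Hodge : Hodge_filtration F).
Variables (gamma : {linear E -> (ratfun k)^o}).
Hypothesis (gamma_hor : horizontal_surjection gamma).
Implicit Types (y : P1 k) (e g v : E) (c : ratfun k).

Lemma gammaZ c v : gamma (c *: v) = c * gamma v.
Proof. by rewrite linearZ. Qed.

Lemma gamma_nabla v : gamma (nabla v) = ddt (gamma v).
Proof. by case: gamma_hor => _ _ ->. Qed.

(** Surjectivity of the Kodaira-Spencer map at the class of [g] gives a preimage [c *: e]. The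
    Leibniz term and the error in [F] are multiples of [e], so comparing coefficients of [g] yields
    [c * b = 1]. *)
Lemma KS_frame y e g : generates F y e -> frame y (@stalk k E y) e g ->
  exists a b b', [/\ nabla_along (tau_log_gen x y) e = a *: e + b *: g,
    regular_at y a, regular_at y b, regular_at y b' & b * b' = 1].
Proof.
move=> he hfg; have [hv hM _] := hfg; set theta := tau_log_gen x y.
have [a [b hab]] := hv (nabla_along theta e).
have /hM [ha hb] : stalk y (a *: e + b *: g).
  by rewrite -hab; apply: nabla_log; apply: frame_mem1 hfg.
have [v /he[c hc ->] /he[d hd]] := (F_Hodge y).2 g (frame_mem2 hfg).
rewrite /nabla_along nabla_Leibniz scalerDr scalerA [_ *: (c *: _)]scalerA.
rewrite [theta * c]mulrC -[_ *: nabla e]scalerA -/(nabla_along theta e) hab.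
move=> h; exists a, b, c; split=> //.
have [] := @frame_inj _ _ _ _ e g (theta * ddt c + c * a + d) (c * b) 0 1 hfg.
  rewrite scale0r scale1r add0r -[g in RHS](subrK (theta * ddt c *: e +
    c *: (a *: e + b *: g))) h !scalerDr !scalerDl !scalerA.
  by rewrite addrAC [RHS]addrC addrA.
by move=> _ <-; rewrite mulrC.
Qed.

(** By horizontality the function is [a * gamma e + b * gamma g]. The first term vanishes at [y],
    while [b] and [gamma g] are units there. *)
Lemma gamma_generator_zero y e : generates F y e -> value_at y (gamma e) 0 ->
  exists2 c : k, c != 0 & value_at y (tau_log_gen x y * ddt (gamma e)) c.
Proof.
move=> he h0; have [_ [g hfg]] := generates_frame he.
have [a [b [b' [hab [a0 ha] [b0 hb] [b0' hb'] bb']]]] := KS_frame he hfg.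
have [hreg hsurj _] := gamma_hor; have [hv hM _] := hfg.
have [g0 hg] := hreg y g (frame_mem2 hfg).
exists (b0 * g0); last first.
  rewrite -gamma_nabla -gammaZ -/(nabla_along _ _) hab linearD !gammaZ.
  by rewrite -[b0 * g0]add0r -(mulr0 a0); apply: value_atD; apply: value_atM.
rewrite mulf_neq0 //.
  apply: contra_neq (oner_neq0 k) => b00; rewrite b00 in hb.
  apply: value_at_inj (value_at_nat y 1) _.
  by rewrite -[1%:R]bb' -(mul0r b0'); apply: value_atM.
(* As [gamma] is surjective on stalks, 1 is a regular combination of [gamma e] and [gamma g]. The
   former vanishes at [y], so the latter cannot. *)
have [v sv gv] := hsurj y 1 (regular_at1 y).
have [c [d vcd]] := hv v; move: sv gv; rewrite vcd => /hM[[c0 hc] [d0 hd]] gv.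
apply: contra_neq (oner_neq0 k) => g00; rewrite g00 in hg.
apply: value_at_inj (value_at_nat y 1) _.
rewrite -[1%:R]gv linearD !gammaZ.
have -> : 0 = c0 * 0 + d0 * 0 :> k by rewrite !mulr0 addr0.
by apply: value_atD; apply: value_atM.
Qed.

Lemma marked_gamma_unit y e (c : k) : y \in codom x -> generates F y e ->
  value_at y (gamma e) c -> c != 0.
Proof.
move=> hy he hc; apply/negP => /eqP c0; rewrite c0 in hc.
have [c' /eqP] := gamma_generator_zero he hc.
rewrite /tau_log_gen hy => + h; apply; apply: value_at_inj h _.
by apply: value_at_sds; exists 0.
Qed.

End HodgeFiltration.

(** * Polynomials over an algebraically closed field and their zeros *)

Section ClosedFields.
Variable k : closedFieldType.
Implicit Types (u v : {poly k}) (S : set (P1 k)).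

(** In lowest terms a nonconstant denominator has a root [a], and regularity at [a] would make the
    numerator vanish there too. *)
Lemma regular_on_A1_poly (f : ratfun k) :
  (forall a, regular_at (Some a) f) -> exists u, f = ofpoly u.
Proof.
move=> hreg; rewrite [f]ofpoly_repr in hreg *.
set n := \n_(repr f) in hreg *; set d := \d_(repr f) in hreg *.
have hd : d != 0 by rewrite /d denom_ratioP.
set g := gcdp n d; pose n1 := n %/ g; pose d1 := d %/ g.
have hg : g != 0 by rewrite gcdp_eq0 negb_and hd orbT.
have en : n = n1 * g by rewrite /n1 divpK // dvdp_gcdl.
have ed : d = d1 * g by rewrite /d1 divpK // dvdp_gcdr.
have hd1 : d1 != 0 by apply: contraNneq hd => d10; rewrite ed d10 mul0r.
have cop : coprimep n1 d1 by apply: coprimep_div_gcd; rewrite hd orbT.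
have ef : ofpoly n / ofpoly d = ofpoly n1 / ofpoly d1.
  by apply/eqP; rewrite ofpoly_div_eq // {1}en {1}ed; apply/eqP; ring.
case: (boolP (size d1 == 1%N)) => [/size_poly1P[c hc dc]|/closed_rootP[a ra]].
  exists (c^-1 *: n1); rewrite ef; apply: (mulIf (_ : ofpoly d1 != 0)).
    by rewrite ofpoly_eq0.
  rewrite divfK ?ofpoly_eq0 // -ofpolyM dc mulrC mul_polyC.
  by rewrite scalerA divff // scale1r.
have [c [n2 [d2 []]]] := hreg a.
rewrite ef => /eqP + [hd2 _].
have hd2' : d2 != 0 by apply: contraNneq hd2 => ->; rewrite horner0.
rewrite ofpoly_div_eq // => /eqP /(congr1 (horner^~ a)).
rewrite !hornerM (eqP ra) mulr0 => /eqP; rewrite mulf_eq0 (negPf hd2) orbF => rn.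
by have := coprimep_root cop rn; rewrite (eqP ra) eqxx.
Qed.

Lemma mup_simple_root u a : root u a -> u^`().[a] != 0 -> mup a u = 1%N.
Proof.
move=> ra hu'; have u0 : u != 0.
  by apply: contraNneq hu' => ->; rewrite deriv0 horner0.
apply/eqP; rewrite eqn_leq mup_leq // -XsubC_dvd // dvdp_XsubCl ra andbT.
apply: contra hu' => /dvdpP[q ->].
by rewrite derivM deriv_exp derivXsubC !hornerE subrr /= mulr0 add0r addrK expr1 mulr0.
Qed.

(** The multiplicity of a root is its number of occurrences in the list of linear factors, so simple
    zeros make this list duplicate-free. *)
Lemma simple_zeros_factor u S : simple_zeros_exactly u S ->
  exists rs : seq k, [/\ uniq rs, forall a, a \in rs <-> S (Some a)
    & u = lead_coef u *: \prod_(a <- rs) ('X - a%:P)].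
Proof.
move=> [u0 hu]; have [rs e] := closed_field_poly_normal u; exists rs.
have lu : lead_coef u != 0 by rewrite lead_coef_eq0.
have hr a : (a \in rs) = root u a by rewrite e rootZ // root_prod_XsubC.
split=> // [|a]; last by rewrite hr; case: (hu a).
apply: count_mem_uniq => a; rewrite hr.
have <- : mup a u = count_mem a rs.
  by rewrite e -mul_polyC mupMr ?mu_prod_XsubC // rootC.
case: (boolP (root u a)) => [ra|]; last by move/mupNroot ->.
by rewrite (hu a).2.
Qed.

(** Both root lists enumerate the affine points of [S], so only the leading coefficients can differ.
    This is the uniqueness in (i). *)
Lemma simple_zeros_unique u v S : simple_zeros_exactly u S ->
  simple_zeros_exactly v S -> exists2 c : k, c != 0 & v = c *: u.
Proof.
move=> hu hv; have [[u0 _] [v0 _]] := (hu, hv).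
have [rs [urs Srs eu]] := simple_zeros_factor hu.
have [rt [urt Srt ev]] := simple_zeros_factor hv.
have rst : perm_eq rs rt.
  apply: uniq_perm => // a; apply/idP/idP; first by move/Srs/Srt.
  by move/Srt/Srs.
have [lu lv] : lead_coef u != 0 /\ lead_coef v != 0 by rewrite !lead_coef_eq0.
exists (lead_coef v / lead_coef u); first by rewrite mulf_neq0 ?invr_eq0.
by rewrite [LHS]ev -(perm_big _ rst) [X in _ = _ *: X]eu scalerA divfK.
Qed.

Lemma number_of_simple_zeros u S : simple_zeros_exactly u S -> ~ S None ->
  number_of_points S = (size u).-1.
Proof.
move=> hu S0; have [rs [urs Srs ->]] := simple_zeros_factor hu.
have lu : lead_coef u != 0 by rewrite lead_coef_eq0; case: hu.
rewrite size_scale // size_prod_XsubC /=.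
have us : uniq (map Some rs) by rewrite map_inj_uniq // => ? ? [].
rewrite -(size_map Some) -(undup_id us) -(size_seq_fset tt) /number_of_points.
have := seq_fsetE tt (map Some rs); move: (seq_fset _ _) => A hA.
(* Presenting [S] as a finite set lets [fset_set] recover it instead of taking its default value. *)
have -> : S = [set` A]%classic.
  apply/seteqP; split=> [[a|]|y] //=; rewrite hA.
    by move/Srs => ha; apply: map_f.
  by move/mapP => [a /Srs ha ->].
by rewrite set_fsetK.
Qed.

End ClosedFields.

(** With [U], [U1], [U2] standing for [u] and its derivatives, the two equations are the
    coefficients of [e0] and [h] in the equation of [u *: e0]. The second determines [p1], then the
    first determines [p2]. *)
Lemma coefs_field_identity (K : fieldType) (t U U1 U2 c p1 p2 : K) :
  t != 0 -> U != 0 -> U2 = - (p2 * U) - p1 * U1 ->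
  U1 * - t^-1 + (- U1 * t - - U) / t ^+ 2 + - U / t * (- t^-1 * c)
    = - (p1 * (- U / t)) ->
  t * p1 = 1 + c - 2%:R * (t * U1 / U) /\
  t ^+ 2 * p2 = - (t * (t * U2) / U) - t * p1 * (t * U1 / U).
Proof.
move=> t0 U0 -> e2; split; last by field.
have -> : t * p1 = - (p1 * (- U / t)) * t ^+ 2 / U by field; apply/andP.
by rewrite -e2; field; apply/andP.
Qed.

(** * The horizontal line [Ker(gamma)] and the coefficients of [L] at infinity *)

Section ExponentsAtInfinity.
Variables (k : fieldType) (r : nat) (x : 'I_r -> P1 k) (E : flat_bundle x).
Variables (F : line_subbundle E) (F_Hodge : Hodge_filtration F).
Variables (gamma : {linear E -> (ratfun k)^o}).
Hypothesis (gamma_hor : horizontal_surjection gamma).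

Lemma sds_fieldE_infty : sds_field (infty k) = - tpar.
Proof. by rewrite /sds_field /= mulrN expr2 mulKf ?tpar_neq0. Qed.

Lemma nabla_of_along_infty (v w : E) :
  nabla_along (sds_field (infty k)) v = w -> nabla v = - tpar^-1 *: w.
Proof.
move=> <-; rewrite /nabla_along sds_fieldE_infty scalerA mulrNN.
by rewrite mulVf ?tpar_neq0 // scale1r.
Qed.

Lemma infty_horizontal_frame (e0 : E) (alpha : k) :
  infty k \in codom x -> generates F (infty k) e0 -> gamma e0 = 1 ->
  local_exponent (ker_stalk gamma) (infty k) alpha ->
  exists (h : E) (c : ratfun k), [/\ frame (infty k) (@stalk k E (infty k)) e0 h,
    nabla e0 = - tpar^-1 *: h, nabla h = - tpar^-1 *: (c *: h)
    & value_at (infty k) c alpha].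
Proof.
move=> hx he0 ge0 [v [[sv gv] vN vexp]].
have tauE : tau_log_gen x (infty k) = sds_field (infty k) by rewrite /tau_log_gen hx.
have [_ [g hfg]] := generates_frame he0.
have [a [b [b' []]]] := KS_frame F_Hodge he0 hfg; rewrite tauE.
set theta := sds_field _ => hab ha hb hb' bb'.
have := frame_shear ha hb hb' bb' hfg; rewrite -hab.
move eh : (nabla_along theta e0) => h hfr; have [hv hM _] := hfr.
have gamma_along w : gamma (nabla_along theta w) = theta * ddt (gamma w).
  by rewrite /nabla_along gammaZ gamma_nabla.
have gh : gamma h = 0.
  by rewrite -eh gamma_along ge0 -ofpoly1 ddt_poly derivC ofpoly0 mulr0.
have gker a' b1 : gamma (a' *: e0 + b1 *: h) = a'.
  by rewrite linearD !gammaZ ge0 gh mulr0 addr0 mulr1.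
(* [gamma] reads off the coefficient of [e0]; it is zero here because [gamma h = 0] and [gamma] is
   horizontal. *)
have [c0 [c hc]] := hv (nabla_along theta h).
have c00 : c0 = 0.
  have := gamma_along h; rewrite hc gker gh => ->.
  by rewrite -ofpoly0 ddt_poly deriv0 ofpoly0 mulr0.
have [_ [cv hcv]] : regular_at (infty k) c0 /\ regular_at (infty k) c.
  apply/hM; rewrite -hc /theta -tauE; apply: nabla_log.
  exact: frame_mem2 hfr.
rewrite c00 scale0r add0r in hc.
have kerE w : ker_stalk gamma (infty k) w <->
    exists2 q, regular_at (infty k) q & w = q *: h.
  split=> [[]|[q hq ->]].
    have [w1 [w2 ->]] := hv w; rewrite gker => + w10.
    by move=> /hM[_ hw2]; exists w2; rewrite // w10 scale0r add0r.
  split; last by rewrite gammaZ gh mulr0.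
  have := (hM 0 q).2; rewrite scale0r add0r; apply; split=> //.
  exact: regular_at0.
have [q [q0 hq] vq] := (kerE v).1 (conj sv gv).
(* If [q] vanished at infinity, the eigenvector [v] would be zero in the fiber of [Ker(gamma)]. *)
have q0N : q0 != 0.
  apply/negP => /eqP q00; apply: vN; rewrite q00 in hq.
  have [q' hq' qE] := value_at_infty0 hq.
  by exists (q' *: h); [apply/kerE; exists q'|rewrite scalerA -qE].
have [w /kerE[q' [q1 hq'] ->]] := vexp.
have -> : nabla_along theta v - ofconst alpha *: v
    = (theta * ddt q + q * c - ofconst alpha * q) *: h.
  rewrite vq /nabla_along nabla_Leibniz scalerDr !scalerA [theta * q]mulrC.
  by rewrite -[_ *: nabla h]scalerA -/(nabla_along theta h) hc !scalerBl scalerDl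
    !scalerA.
rewrite scalerA => eqh.
have [_ eqc] : 0 = 0 :> ratfun k /\
    theta * ddt q + q * c - ofconst alpha * q = local_param (infty k) * q'.
  by apply: frame_inj hfr _; rewrite eqh.
(* Evaluation at infinity kills [theta * ddt q] and the right-hand side, leaving
   [q0 * (cv - alpha) = 0]. *)
have hl := value_atM (value_at_local_param (infty k)) hq'.
have hs : value_at (infty k) (theta * ddt q) 0 by apply: value_at_sds; exists q0.
have := value_atB (value_atD hs (value_atM hq hcv))
  (value_atM (value_at_const _ alpha) hq).
rewrite eqc => /(value_at_inj hl) /eqP.
rewrite mul0r add0r mulrC -mulrBl eq_sym mulf_eq0 (negPf q0N) orbF subr_eq0.
move=> /eqP ecv; exists h, c; split=> //; last by rewrite -ecv.
  exact: nabla_of_along_infty.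
by apply: nabla_of_along_infty; rewrite -hc.
Qed.

(** The numerators of [q1] and [q2] are Euler-type derivatives of size at most [size u], so both
    quotients can be evaluated at infinity from top coefficients. *)
Lemma coefs_of_horizontal_frame (e0 h : E) (c p1 p2 : ratfun k) (u : {poly k}) y :
  u != 0 -> frame y (@stalk k E y) e0 h ->
  nabla e0 = - tpar^-1 *: h -> nabla h = - tpar^-1 *: (c *: h) ->
  nabla (nabla (ofpoly u *: e0))
    = - (p2 *: (ofpoly u *: e0)) - p1 *: nabla (ofpoly u *: e0) ->
  let q1 := ofpoly ('X * u^`()) / ofpoly u in
  let q2 := ofpoly ('X * ('X * u^`()^`())) / ofpoly u in
  tpar * p1 = 1 + c - 2%:R * q1 /\ tpar ^+ 2 * p2 = - q2 - (tpar * p1) * q1.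
Proof.
move=> u0 hfr ne0 nh.
have t0 : ofpoly 'X != 0 :> ratfun k := tpar_neq0 k.
have U0 : ofpoly u != 0 by rewrite ofpoly_eq0.
have n1 : nabla (ofpoly u *: e0)
    = ofpoly u^`() *: e0 + (ofpoly (- u) / tpar) *: h.
  by rewrite nabla_Leibniz ddt_poly ne0 scalerA mulrN ofpolyN mulNr.
have n2 : nabla (nabla (ofpoly u *: e0)) = ofpoly u^`()^`() *: e0
    + (ofpoly u^`() * - tpar^-1 + ddt (ofpoly (- u) / tpar)
       + ofpoly (- u) / tpar * (- tpar^-1 * c)) *: h.
  by rewrite n1 nablaD !nabla_Leibniz ddt_poly ne0 nh !scalerDl !scalerA !mulrA !addrA.
rewrite n2 n1; set U := ofpoly u => eqn.
have rhs : - (p2 *: (U *: e0)) - p1 *: (ofpoly u^`() *: e0 + (ofpoly (- u) / tpar) *: h)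
    = (- (p2 * U) - p1 * ofpoly u^`()) *: e0 + (- (p1 * (ofpoly (- u) / tpar))) *: h.
  by rewrite scalerDr !scalerA opprD !scalerDl !scaleNr addrA.
have [] := frame_inj hfr (etrans eqn rhs).
rewrite /tpar ddt_frac ?polyX_eq0 // derivX derivN mulr1 ofpolyB.
rewrite !ofpolyX !ofpolyM !ofpolyN.
move: (ofpoly u^`()) (ofpoly u^`()^`()) (ofpoly 'X) t0 U0 => U1 U2 t t0.
rewrite -/U; move: {eqn rhs n1 n2 ne0 nh} U => U U0 e1 e2.
exact: (coefs_field_identity t0 U0 e1 e2).
Qed.

End ExponentsAtInfinity.

(** * The polynomial solution and the indicial equation *)

Theorem proposition5p2 (k : closedFieldType) (p : nat) (hp : p \in [pchar k])
    (hp2 : (2 < p)%N) (r : nat) (hr : (3 <= r)%N) (x : 'I_r -> P1 k)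
    (x_inj : injective x) (ir : 'I_r) (hir : ir.+1 = r) (x_infty : x ir = infty k)
    (E : flat_bundle x) (E_indigenous : indigenous E) (E_active : active E p)
    (E_nilpotent : nilpotent E p) (E_normalized : normalized E)
    (F : line_subbundle E) (F_Hodge : Hodge_filtration F)
    (gamma : {linear E -> (ratfun k)^o}) (gamma_hor : horizontal_surjection gamma)
    (e0 : E) (he0 : canonical_section F gamma e0)
    (L : diff_operator k) (hL : associated_operator F L)
    (alpha_r : k) (halpha : local_exponent (ker_stalk gamma) (x ir) alpha_r) :
  let d := number_of_points (supersingular F e0) in
  let is_solution (u : {poly k}) :=
    diff_apply L (ofpoly u) = 0 /\ simple_zeros_exactly u (supersingular F e0) in
  (exists u : {poly k}, is_solution u /\
     forall v : {poly k}, is_solution v -> exists2 c : k, c != 0 & v = c *: u) /\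
  local_exponents_at_infty L (- d%:R + alpha_r) (- d%:R).
Proof.
move=> d is_solution; have [e0F ge0] := he0; have [e1 e1gen L1] := hL.
have marked_infty : infty k \in codom x by rewrite -x_infty codom_f.
have [u gu] : exists u, gamma e1 = ofpoly u.
  apply: regular_on_A1_poly => a; case: gamma_hor => hreg _ _; apply: hreg.
  have [_ [g]] := generates_frame (e1gen a); exact: frame_mem1.
(* Any affine point shows that [e1] spans the generic line of [F]; the point 0 is taken. Applying
   [gamma] to [e0 = c *: e1] identifies [c] as the inverse of [u]. *)
have e1E : e1 = ofpoly u *: e0.
  have [c ec] := sub_line_scale (e1gen 0) e0F.
  have cu : c * ofpoly u = 1 by rewrite -gu -gammaZ -ec.
  by rewrite ec scalerA mulrC cu scale1r.
have u0 : u != 0.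
  apply/negP => /eqP u0; have [_ [g /frame_neq0]] := generates_frame (e1gen 0).
  by rewrite e1E u0 ofpoly0 scale0r eqxx.
have U0 : ofpoly u != 0 by rewrite ofpoly_eq0.
have e0E : e0 = (ofpoly u)^-1 *: e1 by rewrite e1E scalerA mulVf // scale1r.
(* Infinity is marked, so [gamma f] is a unit there for a local generator [f], and [e0] is [f]
   divided by this unit. *)
have e0gen : generates F (infty k) e0.
  have [f [g [hb hf hF]]] := sub_stalkP F (infty k).
  have fgen : generates F (infty k) f := hF.
  have [c ec] := sub_line_scale fgen e0F.
  have [hreg _ _] := gamma_hor.
  have hfr := local_basis_frame hb.
  have [v hv] := hreg _ _ (frame_mem1 hfr).
  have vN := marked_gamma_unit F_Hodge gamma_hor marked_infty fgen hv.
  have cv : c * gamma f = 1 by rewrite -gammaZ -ec.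
  have gf0 : gamma f != 0.
    by apply: contra_eq_neq cv => ->; rewrite mulr0 eq_sym oner_neq0.
  have cE : c = (gamma f)^-1 by apply: (mulIf gf0); rewrite cv mulVf.
  have creg : regular_at (infty k) c.
    by rewrite cE; exists v^-1; apply: value_atV.
  have fE : f = gamma f *: e0 by rewrite ec scalerA mulrC cv scale1r.
  move=> w; split=> [/fgen[b hb' ->]|[b hb' ->]].
    exists (b * gamma f); first by apply: regular_atM => //; exists v.
    by rewrite {1}fE scalerA.
  apply/fgen; exists (b * c); first exact: regular_atM.
  by rewrite ec scalerA.
have zeros : simple_zeros_exactly u (supersingular F e0).
  split=> // a; split.
    (* Since [e0] is [e1] divided by [u] and [e1] generates [F] at [a], a pole of [e0] at [a] is a
       zero of [u]. *)
    rewrite /supersingular /=; split=> [ra /(e1gen a)[c [c0 hc] ec]|ns].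
      have cu : c * ofpoly u = 1.
        by have := congr1 gamma ec; rewrite gammaZ gu ge0.
      have := value_at_inj (value_atM hc (value_at_poly a u)).
      rewrite cu => /(_ _ (value_at_nat _ 1)) /eqP.
      by rewrite (eqP ra) mulr0 eq_sym oner_eq0.
    apply/negPn/negP => ra; apply: ns; apply/(e1gen a).
    exists (ofpoly u)^-1; last exact: e0E.
    by exists u.[a]^-1; apply: value_atV => //; apply: value_at_poly.
  move=> ra; have h0 : value_at (Some a) (gamma e1) 0.
    by rewrite gu -(eqP ra); apply: value_at_poly.
  apply: mup_simple_root => //.
  have unmarked : Some a \notin codom x.
    apply/negP => ha.
    by have := marked_gamma_unit F_Hodge gamma_hor ha (e1gen a) h0; rewrite eqxx.
  have [c cN] := gamma_generator_zero F_Hodge gamma_hor (e1gen a) h0.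
  rewrite /tau_log_gen (negPf unmarked) mul1r gu ddt_poly => hc.
  by rewrite (value_at_inj (value_at_poly a _) hc).
have Lu : diff_apply L (ofpoly u) = 0.
  have := congr1 gamma L1; rewrite linearB linearN !gammaZ !gamma_nabla // gu.
  by rewrite /diff_apply => ->; ring.
split.
  exists u; split=> // v [_ hv]; exact: simple_zeros_unique zeros hv.
(* Infinity is not supersingular because [e0] generates [F] there, so all supersingular points are
   roots of [u]. *)
have dE : d = (size u).-1.
  by apply: number_of_simple_zeros zeros _; apply; apply: generates_mem.
rewrite x_infty in halpha.
have [h [c [hfr ne0 nh hc]]] :=
  infty_horizontal_frame F_Hodge gamma_hor marked_infty e0gen ge0 halpha.
rewrite e1E in L1; have [] := coefs_of_horizontal_frame u0 hfr ne0 nh L1.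
set q1 := _ / _; set q2 := _ / _ => E1 E2.
have hq1 : value_at (infty k) q1 d%:R.
  have := value_at_infty_poly u0 (size_Xderiv u).
  by rewrite coef_Xderiv mulrnAl divff ?lead_coef_eq0 // -dE.
(* These are the values at infinity of [E1] and [E2], where [c], [q1], [q2] become [alpha_r], [d],
   [d (d - 1)]. Hence [c1 - 1 = alpha_r - 2 d] and [c2 = d (d - alpha_r)] are the sum and the
   product of the claimed exponents. *)
pose c1 := 1 + alpha_r - 2%:R * d%:R.
pose c2 := - (d%:R * (d%:R - 1)) - c1 * d%:R.
have hq2 : value_at (infty k) q2 (d%:R * (d%:R - 1)).
  (* The truncated predecessor is harmless at [d = 0], where both sides vanish. *)
  have -> : d%:R * (d%:R - 1) = (d * d.-1)%:R :> k.
    by case: (d) => [|m]; rewrite ?mul0r // natrM -[in X in _ * X]natr1 addrK.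
  have := value_at_infty_poly u0 (size_XXderiv2 u).
  by rewrite coef_XXderiv2 mulrnAl divff ?lead_coef_eq0 // -dE.
have h1 : value_at (infty k) (tpar * Defs.coef1 L) c1.
  rewrite E1; apply: value_atB; first by apply: value_atD (value_at_nat _ 1) hc.
  by apply: value_atM (value_at_nat _ 2) hq1.
exists c1, c2; split=> //.
  by rewrite E2; apply: value_atB (value_atN hq2) (value_atM h1 hq1).
rewrite -mul_polyC /c2 /c1 !(polyCD, polyCN, polyCM, polyCB).
ring.
Qed.
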